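(* Let $p\in\beta\mathbb{N}$ be an idempotent ultrafilter and let $(X,\mu,T)$ be a totally $p$-mixing measure preserving system. Let $p_1,\dots,p_k\in\mathbb{Z}[x]$ be polynomials such that for every $i\neq j$, the polynomial $p_i-p_j$ is not constant. For every $f_1,\dots,f_k\in L^\infty(X)$ we have $$p\text{-}\lim_n\ \prod_{i=1}^kT^{p_i(n)}f_i=\prod_{i=1}^k\int_Xf_i\,d\mu\qquad\text{in the weak topology of }L^2(X).$$
   Context: $\beta\mathbb{N}$ is the set of ultrafilters on $\mathbb{N}=\{1,2,\dots\}$, with the semigroup operation extending addition: $A\in p+q$ iff $\{n:\{m:n+m\in A\}\in q\}\in p$. An ultrafilter $p$ is idempotent if $p+p=p$. For a map $u$ from $\mathbb{N}$ into a compact Hausdorff space, $p\text{-}\lim_n u(n)$ is the unique point $x$ such that $\{n:u(n)\in U\}\in p$ for every neighborhood $U$ of $x$ (bounded sets of $L^2(X)$ being taken with the weak topology). Here $(X,\mu,T)$ is an invertible measure preserving system on a probability space and $T^nf=f\circ T^n$. The system is totally $p$-mixing if for every $f\in L^2(X)$ and every $\ell\in\mathbb{N}$ we have $p\text{-}\lim_nT^{\ell n}f=\int_Xf\,d\mu$ in the weak topology.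
   Formalization: Each polynomial p_i is additionally assumed non-constant; without this the claim fails, e.g. for k=1, p_1=0 and a Bernoulli shift, where it would say that every f_1 is almost everywhere equal to its integral. *)

(* Defs.v *)
From mathcomp Require Import all_boot all_order all_algebra complex.
From mathcomp Require Import all_classical all_reals all_analysis.
Set Implicit Arguments.
Unset Strict Implicit.
Unset Printing Implicit Defensive.
Import Order.TTheory GRing.Theory Num.Theory ComplexField.
Local Open Scope ring_scope.
Local Open Scope classical_set_scope.
Local Open Scope complex_scope.

(* An ultrafilter on {1, 2, ...} is encoded as an ultrafilter on nat that
   contains the set of positive integers.  Without this condition the
   principal ultrafilter at 0 would be an idempotent. *)
Definition betaN (p : set_system nat) : Prop :=
  UltraFilter p /\ p [set n | (0 < n)%N].

Definition ultra_add (p q : set_system nat) : set_system nat :=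
  [set A | p [set n | q [set m | A (n + m)%N]]].

Definition idempotent_ultrafilter (p : set_system nat) : Prop :=
  betaN p /\ ultra_add p p = p.

Section ComplexLp.
Context (d : measure_display) (X : measurableType d) (R : realType).
Variable mu : {measure set X -> \bar R}.

(* Elements of L^q are functions rather than a.e. classes, so weak limits below
   are unique only up to a.e. equality. *)
Definition LpC (q : \bar R) (f : X -> R[i]) : Prop :=
  [/\ measurable_fun [set: X] (fun x => complex.Re (f x)),
      measurable_fun [set: X] (fun x => complex.Im (f x)) &
      finite_norm mu q (fun x => Normc.normc (f x))].

Definition L2C := LpC 2%:E.
Definition LinftyC := LpC +oo%E.

Definition integralC (f : X -> R[i]) : R[i] :=
  Rintegral mu [set: X] (fun x => complex.Re (f x)) +i*
  Rintegral mu [set: X] (fun x => complex.Im (f x)).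

Definition innerC (f g : X -> R[i]) : R[i] :=
  integralC (fun x => f x * conjc (g x)).

(* The neighborhoods of h in the weak topology of L^2: the sets containing,
   among the elements of L^2, a basic neighborhood given by finitely many
   elements g_j of L^2 and some e > 0. *)
Definition weak_nbhs (h : X -> R[i]) : set_system (X -> R[i]) :=
  [set U | exists (m : nat) (g : 'I_m -> X -> R[i]) (e : R),
     [/\ forall j, L2C (g j), 0 < e &
         forall v, L2C v ->
           (forall j, Normc.normc (innerC v (g j) - innerC h (g j)) < e) ->
           U v]].

Definition weak_plim (p : set_system nat) (u : nat -> X -> R[i])
    (h : X -> R[i]) : Prop :=
  L2C h /\ forall U, weak_nbhs h U -> p [set n | U (u n)].

End ComplexLp.

Record invertible_mps (d : measure_display) (X : measurableType d)
    (R : realType) (mu : probability X R) := InvertibleMps {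
  mps_map :> X -> X;
  mps_inv : X -> X;
  mps_mapK : cancel mps_map mps_inv;
  mps_invK : cancel mps_inv mps_map;
  mps_measurable_map : measurable_fun [set: X] mps_map;
  mps_measurable_inv : measurable_fun [set: X] mps_inv;
  mps_preserves : forall A, measurable A -> mu (mps_map @^-1` A) = mu A }.

Section Dynamics.
Context (d : measure_display) (X : measurableType d) (R : realType).
Context (mu : probability X R).

Definition mps_iter (T : invertible_mps mu) (n : int) : X -> X :=
  match n with
  | Posz m => iter m T
  | Negz m => iter m.+1 (mps_inv T)
  end.

Definition koopman (T : invertible_mps mu) (n : int) (f : X -> R[i]) :
    X -> R[i] := f \o mps_iter T n.

Definition totally_p_mixing (p : set_system nat) (T : invertible_mps mu) :
    Prop :=
  forall f, L2C mu f -> forall l : nat, (0 < l)%N ->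
    weak_plim mu p (fun n => koopman T (l * n)%N%:Z f)
      (fun _ => integralC mu f).

End Dynamics.

(* Main.v *)
Require Import Defs.
From mathcomp Require Import all_boot all_order all_algebra complex.
From mathcomp Require Import all_classical all_reals all_analysis.
From mathcomp Require Import measurable_realfun ess_sup_inf polyorder.
From mathcomp Require Import ring lra zify.
Set Implicit Arguments.
Unset Strict Implicit.
Unset Printing Implicit Defensive.
Import Order.TTheory GRing.Theory Num.Theory.
Import numFieldNormedType.Exports.
Local Open Scope ring_scope.
Local Open Scope classical_set_scope.
Local Open Scope complex_scope.

(** The proof is Bergelson's polynomial exhaustion argument, with Cesaro means
    replaced by limits along p.

    Everything rests on a van der Corput inequality for idempotent ultrafilters
    ([ultra_van_der_corput]): a bounded sequence u of L^2 tends weakly to 0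
    along p as soon as the correlations p-lim_n <u(n + h), u(n)> tend to 0 as h
    runs along p.  Otherwise the n with <u(n), g> >= e would form a member of p,
    for some g and e > 0, up to the sign of g.  Since p is idempotent, this
    member contains arbitrarily long lists of indices at which the u(n) are
    pairwise almost orthogonal ([idempotent_finite_configuration]); the sum of N
    such vectors has norm O(sqrt N) up to a small multiple of N, but its inner
    product with g is at least N e.

    Since the statement is multilinear in the functions, one of the f_j can be
    taken to have integral 0, and it is to be shown that
    u(n) = prod_j f_j o T^(P_j(n)) tends weakly to 0
    ([jointly_mixing_mean_zero]).  Let P_0 be a polynomial of least degree.  By
    invariance of the measure, <u(n + h), u(n)> is the integral of a product
    taken along the polynomials P_j(n + h) - P_0(n) and P_j(n) - P_0(n)
    ([orbit_prod_pet]).  If P_j has degree at least 2, both polynomials are kept.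
    If P_j is linear with leading coefficient a, the two differ by the constant
    a h, and only the second is kept, with the function (f_j o T^(a h)) f_j;
    total mixing gives the limit of its integral as h runs along p, namely the
    square of the integral of f_j.  For all but finitely many h the new family
    satisfies the hypotheses of the theorem ([essentially_distinct_pet]), and it
    is simpler than the original one: the degrees above that of P_0 keep the same
    leading coefficients, and the degree of P_0 loses one ([weight_pet_above],
    [weight_pet_at]).  By induction the theorem holds for the new family; the
    correlations therefore converge to a product of integrals which tends to 0
    along p, and the van der Corput inequality applies.

    The induction is carried out for real bounded functions.  The complex case
    follows by splitting each function into its real and imaginary parts
    ([innerC_koopman_prod_cvg]), and essentially bounded functions are truncated,
    which changes them only on a null set. *)

(** * Idempotent ultrafilters *)

Section IdempotentUltrafilter.
Context (p : set_system nat) (hp : idempotent_ultrafilter p).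

Lemma idempotent_ultra : UltraFilter p.
Proof. by case: hp => -[]. Qed.
#[local] Existing Instance idempotent_ultra.

Lemma idempotent_shift (A : set nat) :
  p A -> p [set n | p [set m | A (n + m)%N]].
Proof. by case: hp => _ {1}<-. Qed.

(** If p were principal at n, idempotence would force n + n = n, whereas p
    contains the positive integers. *)
Lemma idempotent_neq (n : nat) : p [set m | m != n].
Proof.
have [pn|] := in_ultra_setVsetC [set n] idempotent_ultra; last first.
  by apply: filterS => m /= mn; apply/eqP.
have [[_ pos] _] := hp.
have [m [-> n_gt0]] := filter_ex (filterI pn pos).
have [_ [-> pA]] := filter_ex (filterI pn (idempotent_shift pn)).
have [q [/= qn qE]] := filter_ex (filterI pn pA).
by move: qE n_gt0; rewrite /= qn; lia.
Qed.

Lemma idempotent_large_seq (A : set nat) (n : nat) : p A ->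
  exists s : seq nat, [/\ uniq s, size s = n & {in s, forall m, A m}].
Proof.
move=> pA; elim: n => [|n [s [us ss As]]]; first by exists [::].
have : p [set m | m \notin s].
  elim: s {us ss As} => [|x s IH]; first by apply: filterS filterT.
  apply: filterS (filterI (idempotent_neq x) IH) => m [/= mx ms].
  by rewrite inE negb_or mx.
move=> /(filterI pA)/filter_ex[m [Am /= ms]]; exists (m :: s); split => /=.
- by rewrite ms.
- by rewrite ss.
- by move=> k; rewrite inE => /predU1P[->//|/As].
Qed.

(** Members of p are infinite, and a nonzero polynomial has finitely many
    roots. *)
Lemma idempotent_nonroot (q : {poly int}) :
  q != 0 -> p [set n | q.[n%:Z] != 0].
Proof.
move=> q0.
have [pA|] := in_ultra_setVsetC [set n | q.[n%:Z] = 0] idempotent_ultra; last first.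
  by apply: filterS => n /= qn; apply/eqP.
have [s [us ss sA]] := idempotent_large_seq (size q) pA.
suff : (size [seq Posz i | i <- s] < size q)%N by rewrite size_map ss ltnn.
apply: max_poly_roots => //.
- by apply/allP => _ /mapP[n /sA/= qn ->]; apply/rootP.
- by rewrite map_inj_uniq//; move=> a b [].
Qed.

(** In the manner of the ultrafilter proof of Hindman's theorem, the list is built
    as a translate L + m of a list of offsets L, such that for p-many m all
    entries of L + m lie in A and in the set B of good differences, and are
    pairwise related.
    One passes from L to (L + n) ++ [0]: for p-many n, idempotence turns the
    property of L at p-many m into the property of L + n at p-many m, and the
    new relations, between l + n + m and m, hold because l + n is in B. *)
Lemma idempotent_finite_configuration (A : set nat) (r : rel nat) (N : nat) :
  p A -> p [set h | p [set n | r (h + n)%N n]] ->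
  exists s : seq nat, [/\ size s = N.+1, {in s, forall m, A m} & pairwise r s].
Proof.
move=> pA; set B := [set h | _] => pB;
have pAB : p (A `&` B) by exact: filterI.
suff [L [sL PL]] : exists L : seq nat, size L = N.+1 /\
    p [set m | (forall i, (i <= N)%N -> (A `&` B) (nth 0 L i + m)%N) /\
       (forall i j, (i < j <= N)%N -> r (nth 0 L i + m)%N (nth 0 L j + m)%N)].
  have [m [mA mr]] := filter_ex PL.
  exists [seq (l + m)%N | l <- L]; split; first by rewrite size_map.
  - move=> _ /mapP[l lL ->].
    by have [] := mA (index l L); rewrite ?nth_index// -ltnS -sL index_mem.
  - apply/(pairwiseP 0%N) => i j; rewrite !inE size_map sL !ltnS => iN jN ij.
    by rewrite !(nth_map 0%N) ?sL ?ltnS//; apply: mr; rewrite ij.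
elim: N => [|N [L [sL pL]]].
  exists [:: 0%N]; split => //; apply: filterS pAB => m ABm; split.
    by case.
  by move=> i j; lia.
set S := [set m | _] in pL.
have [n [[SnA Snr] pSn]] := filter_ex (filterI pL (idempotent_shift pL)).
(* For n in S, the entries l + n lie in B, which relates l + n + m to m. *)
exists (rcons [seq (l + n)%N | l <- L] 0%N); split.
  by rewrite size_rcons size_map sL.
have nthL i : (i <= N)%N ->
    nth 0%N (rcons [seq (l + n)%N | l <- L] 0%N) i = (nth 0%N L i + n)%N.
  by move=> iN; rewrite nth_rcons size_map sL ltnS iN (nth_map 0%N) ?sL.
have nthN : nth 0%N (rcons [seq (l + n)%N | l <- L] 0%N) N.+1 = 0%N.
  by rewrite nth_rcons size_map sL ltnn eqxx.
have rB : p [set m | forall i, (i <= N)%N -> r (nth 0 L i + n + m)%N m].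
  have : forall k, (k <= N.+1)%N ->
      p [set m | forall i, (i < k)%N -> r (nth 0 L i + n + m)%N m].
    elim=> [_|k IH kN]; first by apply: filterS filterT.
    have [_ Bk] := SnA k kN.
    apply: filterS (filterI (IH (ltnW kN)) Bk) => m [mk rk] i.
    by rewrite ltnS leq_eqVlt => /predU1P[->//|/mk].
  by move=> /(_ N.+1 (leqnn _)); apply: filterS => m mN i iN; exact: mN.
apply: filterS (filterI (filterI pAB rB) pSn) => m [[ABm rBm] [SA Sr]]; split.
- move=> i; rewrite leq_eqVlt => /predU1P[->|iN]; first by rewrite nthN.
  by rewrite nthL// -addnA; exact: SA.
- move=> i j /andP[ij]; rewrite leq_eqVlt => /predU1P[jN|jN].
    by rewrite jN in ij *; rewrite nthN nthL//; exact: rBm.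
  rewrite !nthL// -?addnA; first by apply: Sr; rewrite ij.
  exact: leq_trans (ltnW ij) jN.
Qed.
End IdempotentUltrafilter.

(** * Polynomial families and their weights *)

(** Functions that may decrease only at a place below n, and are then arbitrary
    at smaller places, are ordered lexicographically on finitely many places. *)
Lemma top_lexicographic_ind (n : nat) (Q : (nat -> nat) -> Prop) :
  (forall w, (forall w', (exists d, [/\ (d < n)%N, (w' d < w d)%N &
        forall e, (d < e)%N -> w' e = w e]) -> Q w') -> Q w) ->
  forall w, Q w.
Proof.
elim: n Q => [|n IH] Q HQ w; first by apply: HQ => w' [d []].
suff: forall a v, v n = a -> Q v by move=> /(_ (w n) w erefl).
move=> a; elim/ltn_ind: a => a IHa; apply: (IH (fun v => v n = a -> Q v)).
move=> {}w IHw wn; apply: HQ => w' [d [dn w'd w'e]].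
move: dn; rewrite ltnS leq_eqVlt => /predU1P[dn|dn].
  by apply: (IHa (w' n)) => //; rewrite -wn -dn.
by apply: IHw; [exists d | rewrite w'e].
Qed.

Lemma filter_all_seq (T : Type) (F : set_system T) (FF : Filter F) (I : eqType)
    (s : seq I) (A : I -> set T) :
  {in s, forall i, F (A i)} -> F [set t | {in s, forall i, A i t}].
Proof.
elim: s => [|i s IH] FA; first by apply: filterS filterT => t _ ?.
have Fi : F (A i) by apply: FA; rewrite mem_head.
have Fs : F [set t | {in s, forall i, A i t}].
  by apply: IH => j js; apply: FA; rewrite inE js orbT.
apply: filterS (filterI Fi Fs) => t [Ait Ast] j.
by rewrite inE => /predU1P[->//|/Ast].
Qed.

Definition shift_poly (h : nat) (q : {poly int}) : {poly int} :=
  q \Po ('X + (h%:Z)%:P).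

Lemma horner_shift_poly h q (n : nat) :
  (shift_poly h q).[n%:Z] = q.[(n + h)%N%:Z].
Proof. by rewrite horner_comp !hornerE. Qed.

Lemma size_shift_poly h q : size (shift_poly h q) = size q.
Proof. by rewrite size_comp_poly2// size_XaddC. Qed.

Lemma lead_coef_shift_poly h q : lead_coef (shift_poly h q) = lead_coef q.
Proof.
by rewrite lead_coef_comp ?size_XaddC// lead_coefXaddC expr1n mulr1.
Qed.

Lemma shift_polyB h q r :
  shift_poly h (q - r) = shift_poly h q - shift_poly h r.
Proof. exact: rmorphB. Qed.

Lemma horner_linear (q : {poly int}) (n h : nat) : size q = 2 ->
  q.[(n + h)%N%:Z] = q.[n%:Z] + lead_coef q * h%:Z.
Proof.
move=> sq; rewrite !horner_coef sq !big_ord_recl !big_ord0 /= lead_coefE sq.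
by rewrite !addr0 !expr0 !expr1 PoszD; ring.
Qed.

(** If q(x + h) - r(x) is constant then q'(x + h) = r'(x); at x = 0 this says
    that h is a root of q' - r'(0), which is not zero because q' is not
    constant. *)
Lemma nonconstant_shift_polyB (p : set_system nat)
    (hp : idempotent_ultrafilter p) (q r : {poly int}) :
  (2 < size q)%N -> p [set h | (1 < size (shift_poly h q - r)%R)%N].
Proof.
move=> sq; pose c := (r^`()).[0].
have qc : q^`() - c%:P != 0.
  rewrite subr_eq0; apply/eqP => /(congr1 (fun u : {poly int} => size u)).
  by rewrite size_deriv size_polyC; case: (c != 0) => /= E;
    move: sq; case: (size q) E => [|[|[|?]]].
have := idempotent_nonroot hp qc.
have := idempotent_ultra hp => pU.
apply: filterS => h /=; apply: contraNT; rewrite -leqNgt => /size1_polyC qr.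
have : deriv (shift_poly h q - r) = 0 by rewrite qr derivC.
rewrite derivB deriv_comp derivD derivX derivC addr0 mulr1.
move=> /(congr1 (fun u => u.[0])); rewrite !hornerE horner_comp !hornerE.
by move=> <-; rewrite /c.
Qed.

Section Weight.
Context (I : eqType).
Implicit Types (s : seq I) (P : I -> {poly int}).

Definition essentially_distinct s P :=
  {in s, forall i, (1 < size (P i))%N} /\
  {in s &, forall i j, i != j -> (1 < size (P i - P j)%R)%N}.

(** Polynomials with the same degree and leading coefficient count once, since
    subtracting one of them lowers the degree of all of them. *)
Definition weight s P (m : nat) : nat :=
  size (undup [seq lead_coef (P i) | i <- s & size (P i) == m]).

Lemma mem_weight s P m c :
  reflect (exists i, [/\ i \in s, size (P i) = m & c = lead_coef (P i)])
    (c \in [seq lead_coef (P i) | i <- s & size (P i) == m]).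
Proof.
apply: (iffP mapP) => [[j]|[j [si /eqP mi ci]]].
  by rewrite mem_filter => /andP[/eqP mi si] ci; exists j.
by exists j => //; rewrite mem_filter mi.
Qed.
End Weight.

Section PETStep.
Context (I : eqType) (s : seq I) (P : I -> {poly int}) (i0 : I).

(** After subtraction of P i0, the index inl i stands for the shifted polynomial
    P i (n + h) and inr i for P i n.  Only the latter is kept when P i is linear,
    since the two then differ by a constant; inr i0 is left out, as it would
    give the polynomial 0. *)
Definition pet_seq : seq (I + I) :=
  [seq inl i | i <- s & (2 < size (P i))%N] ++ [seq inr i | i <- s & i != i0].

Definition pet_poly (h : nat) (k : I + I) : {poly int} :=
  match k with inl i => shift_poly h (P i) | inr i => P i end - P i0.

Lemma mem_pet_seq_inl i : (inl i \in pet_seq) = (2 < size (P i))%N && (i \in s).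
Proof.
rewrite mem_cat mem_map; last by move=> a b [].
rewrite mem_filter [X in _ || X](_ : _ = false) ?orbF//.
by apply/negP => /mapP[].
Qed.

Lemma mem_pet_seq_inr i : (inr i \in pet_seq) = (i != i0) && (i \in s).
Proof.
rewrite mem_cat orbC mem_map; last by move=> a b [].
rewrite mem_filter [X in _ || X](_ : _ = false) ?orbF//.
by apply/negP => /mapP[].
Qed.

Lemma uniq_pet_seq : uniq s -> uniq pet_seq.
Proof.
move=> us; rewrite cat_uniq !map_inj_uniq ?filter_uniq//=; last 2 first.
- by move=> a b [].
- by move=> a b [].
by rewrite andbT; apply/hasPn => _ /mapP[i _ ->]; apply/negP => /mapP[].
Qed.

Hypothesis (si0 : i0 \in s).
Hypothesis min_i0 : {in s, forall i, size (P i0) <= size (P i)}%N.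
Hypothesis edP : essentially_distinct s P.

(** Differences within the shifted or within the unshifted polynomials are
    differences of the original ones, up to a shift; a difference between a
    shifted and an unshifted one is nonconstant for all but finitely many h. *)
Lemma essentially_distinct_pet (p : set_system nat)
    (hp : idempotent_ultrafilter p) :
  p [set h | essentially_distinct pet_seq (pet_poly h)].
Proof.
have [nc nd] := edP; have pU := idempotent_ultra hp.
have : p [set h | {in s, forall i, {in s, forall j, (2 < size (P i))%N ->
    (1 < size (shift_poly h (P i) - P j)%R)%N}}].
  apply: filter_all_seq => i si; apply: filter_all_seq => j sj.
  have [lt2|_] := ltnP 2 (size (P i)); last by apply: filterS filterT.
  by apply: filterS (nonconstant_shift_polyB hp (P j) lt2) => h.
apply: filterS => h hP; split=> [[i|i]|].
- by rewrite mem_pet_seq_inl => /andP[s2 si]; apply: hP.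
- by rewrite mem_pet_seq_inr => /andP[ii0 si]; apply: nd.
have sub (a b c : {poly int}) : (a - c) - (b - c) = a - b by ring.
move=> [i|i] [j|j]; rewrite ?mem_pet_seq_inl ?mem_pet_seq_inr => /andP[i1 i2];
  move=> /andP[j1 j2] ij; rewrite /pet_poly sub.
- by rewrite -shift_polyB size_shift_poly nd.
- exact: hP.
- by rewrite -opprB size_polyN hP.
- exact: nd.
Qed.

(** All that matters for the weights: each new polynomial is Q - P i0, where Q
    has the degree and the leading coefficient of an original polynomial. *)
Lemma pet_polyE h k : k \in pet_seq -> exists i (Q : {poly int}),
  [/\ i \in s, size Q = size (P i), lead_coef Q = lead_coef (P i) &
      pet_poly h k = Q - P i0].
Proof.
case: k => i; rewrite ?mem_pet_seq_inl ?mem_pet_seq_inr => /andP[_ si].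
  exists i, (shift_poly h (P i)).
  by rewrite size_shift_poly lead_coef_shift_poly.
by exists i, (P i).
Qed.

Lemma size_pet_poly_le h n : {in s, forall i, size (P i) <= n}%N ->
  {in pet_seq, forall k, size (pet_poly h k) <= n}%N.
Proof.
move=> sn k /(pet_polyE h)[i [Q [si sQ _ ->]]].
by rewrite (leq_trans (size_polyD _ _))// size_polyN geq_max sQ !sn.
Qed.

Lemma weight_pet_above h m : (size (P i0) < m)%N ->
  weight pet_seq (pet_poly h) m = weight s P m.
Proof.
move=> i0m; apply/perm_size/uniq_perm; rewrite ?undup_uniq// => c.
rewrite !mem_undup; apply/mem_weight/mem_weight.
- move=> [k [/(pet_polyE h)[i [Q [si sQ lQ ->]]]]] sm cE; exists i.
  have lt : (size (- P i0) < size Q)%N.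
    rewrite size_polyN ltnNge; apply/negP => le.
    have := size_polyD Q (- P i0); rewrite size_polyN sm.
    by rewrite (maxn_idPr le) leqNgt i0m.
  by rewrite cE lead_coefDl// lQ -sQ -sm size_polyDl.
- move=> [i [si sm ->]]; exists (inr i).
  have lt : (size (- P i0) < size (P i))%N by rewrite size_polyN sm.
  rewrite mem_pet_seq_inr si andbT /pet_poly size_polyDl// lead_coefDl//.
  by split => //; apply: contraTneq i0m => <-; rewrite sm ltnn.
Qed.

(** Polynomials of the degree of P i0 have their leading coefficient translated
    by - lead_coef (P i0), and those with the same leading coefficient as P i0
    fall to a lower degree. *)
Lemma weight_pet_at h :
  (weight pet_seq (pet_poly h) (size (P i0)) < weight s P (size (P i0)))%N.
Proof.
set m := size (P i0); pose c0 := lead_coef (P i0).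
rewrite /weight; set L' := undup _; set L := undup _.
have m0 : (0 < m)%N by rewrite /m; case: edP => /(_ _ si0); lia.
suff sub : {subset c0 :: [seq c + c0 | c <- L'] <= L}.
  rewrite -[size L'](size_map (fun c => c + c0)).
  apply: (uniq_leq_size _ sub) => /=.
  rewrite map_inj_uniq ?undup_uniq ?andbT; last exact: addIr.
  apply/negP => /mapP[c]; rewrite mem_undup => /mem_weight[k [_ sk ck]] c0E.
  have c_eq0 : c = 0 by apply: (@addIr _ c0); rewrite add0r -c0E.
  move: ck; rewrite c_eq0 => /esym/eqP; rewrite lead_coef_eq0 -size_poly_eq0 sk.
  by rewrite gtn_eqF.
move=> c; rewrite inE mem_undup => /predU1P[->|]; first by apply/mem_weight; exists i0.
move=> /mapP[c']; rewrite mem_undup => /mem_weight[k [kp sk ->]] ->.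
have [i [Q [si sQ lQ kQ]]] := pet_polyE h kp; rewrite kQ in sk *.
have sQm : size Q = m.
  apply/eqP; rewrite eqn_leq sQ min_i0// andbT leqNgt -sQ; apply/negP => lt.
  by move: (lt); rewrite -sk size_polyDl ?size_polyN// ltnn.
apply/mem_weight; exists i; split => //; first by rewrite -sQ.
by rewrite lead_coefE sk coefB -lQ /c0 !lead_coefE sQm -/m subrK.
Qed.
End PETStep.

(** * Integration and the van der Corput inequality *)

Section Integration.
Context (d : measure_display) (X : measurableType d) (R : realType).
Context (mu : probability X R).
Implicit Types f g : X -> R.

Local Notation I := (Rintegral mu [set: X]).
Local Notation integrableR f := (mu.-integrable [set: X] (EFin \o f)).

Definition bounded_measurable f :=
  measurable_fun [set: X] f /\ exists M, forall x, `|f x| <= M.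

Definition square_integrable f :=
  measurable_fun [set: X] f /\ integrableR (fun x => f x ^+ 2).

Lemma meanB f g : integrableR f -> integrableR g ->
  I (fun x => f x - g x) = I f - I g.
Proof. exact: RintegralB. Qed.
Lemma meanZ c f : integrableR f -> I (fun x => c * f x) = c * I f.
Proof. exact: RintegralZl. Qed.
Lemma mean_cst c : I (fun=> c) = c.
Proof. by rewrite Rintegral_cst//= probability_setT mulr1. Qed.
Lemma meanD f g : integrableR f -> integrableR g ->
  I (fun x => f x + g x) = I f + I g.
Proof. exact: RintegralD. Qed.

Lemma integrableRD f g : integrableR f -> integrableR g ->
  integrableR (fun x => f x + g x).
Proof. by move=> fi gi; apply: eq_integrable (integrableD _ fi gi). Qed.

Lemma integrableRB f g : integrableR f -> integrableR g ->
  integrableR (fun x => f x - g x).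
Proof. by move=> fi gi; apply: eq_integrable (integrableB _ fi gi). Qed.

Lemma integrableRZ c f : integrableR f -> integrableR (fun x => c * f x).
Proof. by move=> fi; apply: eq_integrable (integrableZl _ c fi). Qed.

Lemma integrableR_sum (J : Type) (s : seq J) (F : J -> X -> R) :
  (forall j, integrableR (F j)) -> integrableR (fun x => \sum_(j <- s) F j x).
Proof.
move=> Fi; elim: s => [|j s IH].
  under [X in EFin \o X]eq_fun do rewrite big_nil.
  exact: finite_measure_integrable_cst.
under [X in EFin \o X]eq_fun do rewrite big_cons.
exact: integrableRD.
Qed.

Lemma mean_sum (J : Type) (s : seq J) (F : J -> X -> R) :
  (forall j, integrableR (F j)) ->
  I (fun x => \sum_(j <- s) F j x) = \sum_(j <- s) I (F j).
Proof.
move=> Fi; elim: s => [|j s IH].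
  rewrite big_nil; under [X in I X]eq_fun do rewrite big_nil.
  exact: mean_cst.
rewrite big_cons -IH -meanD//; last exact: integrableR_sum.
by under [X in I X]eq_fun do rewrite big_cons.
Qed.

Lemma bounded_measurable_integrable f : bounded_measurable f -> integrableR f.
Proof.
move=> [mf [M fM]]; apply: measurable_bounded_integrable => //.
  by rewrite /= probability_setT ltry.
exists M; split; first exact: num_real.
by move=> N MN x _; rewrite /= (le_trans (fM x))// ltW.
Qed.

Lemma bounded_measurable_cst c : bounded_measurable (fun=> c).
Proof. by split; [exact: measurable_cst|exists `|c|]. Qed.

Lemma bounded_measurableM f g : bounded_measurable f -> bounded_measurable g ->
  bounded_measurable (fun x => f x * g x).
Proof.
move=> [mf [M fM]] [mg [N gN]]; split; first exact: measurable_funM.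
by exists (M * N) => x; rewrite normrM ler_pM.
Qed.

Lemma bounded_measurableD f g : bounded_measurable f -> bounded_measurable g ->
  bounded_measurable (fun x => f x + g x).
Proof.
move=> [mf [M fM]] [mg [N gN]]; split; first exact: measurable_funD.
by exists (M + N) => x; rewrite (le_trans (ler_normD _ _))// lerD.
Qed.

Lemma bounded_measurableB f g : bounded_measurable f -> bounded_measurable g ->
  bounded_measurable (fun x => f x - g x).
Proof.
move=> [mf [M fM]] [mg [N gN]]; split; first exact: measurable_funB.
by exists (M + N) => x; rewrite (le_trans (ler_normB _ _))// lerD.
Qed.

Lemma bounded_measurable_sum (J : Type) (s : seq J) (F : J -> X -> R) :
  (forall j, bounded_measurable (F j)) ->
  bounded_measurable (fun x => \sum_(j <- s) F j x).
Proof.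
move=> Fi; elim: s => [|j s IH].
  under eq_fun do rewrite big_nil; exact: bounded_measurable_cst.
under eq_fun do rewrite big_cons; exact: bounded_measurableD.
Qed.

Lemma bounded_measurable_prod (J : eqType) (s : seq J) (F : J -> X -> R) :
  {in s, forall j, bounded_measurable (F j)} ->
  bounded_measurable (fun x => \prod_(j <- s) F j x).
Proof.
move=> Fi; elim: s Fi => [|j s IH] Fi.
  under eq_fun do rewrite big_nil; exact: bounded_measurable_cst.
under eq_fun do rewrite big_cons; apply: bounded_measurableM.
  by apply: Fi; rewrite mem_head.
by apply: IH => i si; apply: Fi; rewrite inE si orbT.
Qed.

Lemma bounded_integrableRM f g : bounded_measurable f -> integrableR g ->
  integrableR (fun x => f x * g x).
Proof.
move=> [mf [M fM]] gi; apply: eq_integrable (integrableMr _ mf _ gi) => //.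
exists M; split; first exact: num_real.
by move=> N MN x _; rewrite /= (le_trans (fM x))// ltW.
Qed.

Lemma square_integrable_integrable g : square_integrable g -> integrableR g.
Proof.
move=> [mg g2].
have g21 : integrableR (fun x => 1 + g x ^+ 2).
  by apply: integrableRD => //; exact: finite_measure_integrable_cst.
apply: (le_integrable _ _ _ g21) => //.
  exact/measurable_EFinP.
move=> x _ /=; rewrite lee_fin [leRHS]ger0_norm; last first.
  by rewrite addr_ge0// sqr_ge0.
have := real_normK (num_real (g x)); nra.
Qed.

Lemma bounded_square_integrable f : bounded_measurable f -> square_integrable f.
Proof.
move=> bf; split; first by case: bf.
by apply: bounded_measurable_integrable; exact: bounded_measurableM.
Qed.

(** Expansion of the square: the diagonal terms are at most M ^+ 2 and the
    others at most delta. *)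
Lemma mean_sqr_sum_le (u : nat -> X -> R) (M delta : R) (s : seq nat) :
  (forall n, measurable_fun setT (u n)) -> (forall n x, `|u n x| <= M) ->
  0 <= delta ->
  pairwise (fun m n => I (fun x => u m x * u n x) <= delta) s ->
  I (fun x => (\sum_(n <- s) u n x) ^+ 2)
    <= (size s)%:R * M ^+ 2 + (size s)%:R ^+ 2 * delta.
Proof.
move=> mu_ uM delta0.
have bu n : bounded_measurable (u n) by split => //; exists M.
elim: s => [_|m s IH /=].
  under [X in I X]eq_fun do rewrite big_nil expr0n /=.
  by rewrite mean_cst expr0n /= !mul0r add0r.
move=> /andP[/allP ms /IH{}IH].
pose W x := \sum_(n <- s) u n x.
have bW : bounded_measurable W by exact: bounded_measurable_sum.
rewrite (_ : I _ = I (fun x => u m x * u m x) + 2 * I (fun x => u m x * W x)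
    + I (fun x => W x ^+ 2)); last first.
  have uu : integrableR (fun x => u m x * u m x).
    by apply: bounded_measurable_integrable; exact: bounded_measurableM.
  have uW : integrableR (fun x => 2 * (u m x * W x)).
    by apply/integrableRZ/bounded_measurable_integrable; exact: bounded_measurableM.
  have WW : integrableR (fun x => W x ^+ 2).
    by apply: bounded_measurable_integrable; exact: bounded_measurableM.
  rewrite -meanZ; last by apply: bounded_measurable_integrable; exact: bounded_measurableM.
  rewrite -meanD// -meanD//; last exact: integrableRD.
  by congr (I _); apply/funext => x; rewrite big_cons /W; ring.
have I1 : I (fun x => u m x * u m x) <= M ^+ 2.
  rewrite -[leRHS]mean_cst; apply: le_Rintegral => //.
  - by apply: bounded_measurable_integrable; exact: bounded_measurableM.
  - exact: finite_measure_integrable_cst.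
  - by move=> x _; rewrite -expr2 -real_normK ?num_real// lerXn2r ?nnegrE// (le_trans _ (uM m x)).
have I2 : I (fun x => u m x * W x) <= (size s)%:R * delta.
  rewrite (_ : I _ = \sum_(n <- s) I (fun x => u m x * u n x)).
    rewrite big_seq (le_trans (ler_sum _ ms))// -big_seq big_const_seq count_predT.
    by rewrite iter_addr_0 mulr_natl.
  rewrite -mean_sum; first by congr (I _); apply/funext => x; rewrite mulr_sumr.
  by move=> n; apply: bounded_measurable_integrable; exact: bounded_measurableM.
rewrite -natr1; have : 0 <= (size s)%:R :> R by [].
move: IH; rewrite -/W; nra.
Qed.

(** Expansion of the square of the norm of W - t g, for W the sum of the u n. *)
Lemma almost_orthogonal_bound (u : nat -> X -> R) (M delta e t : R)
    (s : seq nat) g :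
  (forall n, measurable_fun setT (u n)) -> (forall n x, `|u n x| <= M) ->
  square_integrable g -> 0 <= delta -> 0 <= t ->
  pairwise (fun m n => I (fun x => u m x * u n x) <= delta) s ->
  {in s, forall n, e <= I (fun x => u n x * g x)} ->
  2 * t * ((size s)%:R * e) <= (size s)%:R * M ^+ 2 + (size s)%:R ^+ 2 * delta
    + t ^+ 2 * I (fun x => g x ^+ 2).
Proof.
move=> mu_ uM sg delta0 t0 /(mean_sqr_sum_le mu_ uM delta0) HW He.
have bu n : bounded_measurable (u n) by split => //; exists M.
pose W x := \sum_(n <- s) u n x.
have bW : bounded_measurable W by exact: bounded_measurable_sum.
have gi := square_integrable_integrable sg.
have WgE : I (fun x => W x * g x) = \sum_(n <- s) I (fun x => u n x * g x).
  rewrite -mean_sum; first by congr (I _); apply/funext => x; rewrite mulr_suml.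
  by move=> n; exact: bounded_integrableRM.
have Wg : (size s)%:R * e <= I (fun x => W x * g x).
  rewrite WgE big_seq (le_trans _ (ler_sum _ He))//.
  by rewrite -big_seq big_const_seq count_predT iter_addr_0 mulr_natl.
have : 0 <= I (fun x => (W x - t * g x) ^+ 2).
  by apply: Rintegral_ge0 => x _; exact: sqr_ge0.
rewrite (_ : I _ = I (fun x => W x ^+ 2) - (2 * t) * I (fun x => W x * g x)
    + t ^+ 2 * I (fun x => g x ^+ 2)); last first.
  have W2 : integrableR (fun x => W x ^+ 2).
    by apply: bounded_measurable_integrable; exact: bounded_measurableM.
  have Wgi := bounded_integrableRM bW gi; have [_ g2] := sg.
  rewrite -!meanZ// -meanB//; last exact: integrableRZ.
  rewrite -meanD; [|by apply: integrableRB => //; exact: integrableRZ|exact: integrableRZ].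
  by congr (I _); apply/funext => x; ring.
move: HW; rewrite -/W; nra.
Qed.

(** If the integrals against g were at least e on a member of p, there would be
    N pairwise almost orthogonal vectors with this property for every N.  In
    [almost_orthogonal_bound], with t proportional to N, the left side then
    exceeds the right side by a multiple of N ^+ 2 when N is large. *)
Lemma ultra_van_der_corput (p : set_system nat) (hp : idempotent_ultrafilter p)
    (u : nat -> X -> R) (M : R) (c : nat -> R) :
  (forall n, measurable_fun setT (u n)) -> (forall n x, `|u n x| <= M) ->
  p [set h | I (fun x => u (n + h)%N x * u n x) @[n --> p] --> c h] ->
  c @ p --> 0 ->
  forall g, square_integrable g -> I (fun x => u n x * g x) @[n --> p] --> 0.
Proof.
move=> mu_ uM uc c0.
have pU := idempotent_ultra hp.
have key (e : R) g : 0 < e -> square_integrable g ->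
    ~ p [set n | e <= I (fun x => u n x * g x)].
  move=> e0 sg pA.
  pose G := I (fun x => g x ^+ 2).
  have G0 : 0 <= G by apply: Rintegral_ge0 => x _; exact: sqr_ge0.
  (* With t * (G + 1) = e one has t ^+ 2 * G < t * e, so that for N vectors and
     the parameter N * t the terms in N ^+ 2 on the left exceed those on
     the right by more than delta * N ^+ 2. *)
  pose t := e / (G + 1).
  have tG : t * (G + 1) = e by rewrite /t divfK// gt_eqF// ltr_wpDl.
  have t0 : 0 < t by rewrite divr_gt0// ltr_wpDl.
  pose delta := t * e / 2.
  have delta0 : 0 < delta by apply: divr_gt0 => //; exact: mulr_gt0.
  have pr : p [set h | p [set n |
      I (fun x => u (h + n)%N x * u n x) <= delta]].
    have d2 : 0 < delta / 2 by rewrite divr_gt0.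
    have : p [set h | `|0 - c h| < delta / 2] by move/cvgrPdist_lt: c0; apply.
    move/(filterI uc); apply: filterS => h [/= uch ch].
    have : p [set n | `|c h - I (fun x => u (n + h)%N x * u n x)| < delta / 2].
      by move/cvgrPdist_lt: uch; apply.
    apply: filterS => n /=; rewrite (addnC n h).
    move: ch; rewrite sub0r normrN => /ltr_normlP[_ c1] /ltr_normlP[c2 _].
    rewrite ltW//; lra.
  (* Then N.+1 * delta exceeds the contribution M ^+ 2 of the diagonal. *)
  pose N := Num.truncn (M ^+ 2 / delta).
  have [s [sN sA sr]] := @idempotent_finite_configuration p hp _
    (fun m n => I (fun x => u m x * u n x) <= delta) N pA pr.
  have NM : M ^+ 2 < N.+1%:R * delta.
    by rewrite -ltr_pdivrMr// truncnS_gt.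
  have N0 : 0 < N.+1%:R :> R by rewrite ltr0n.
  have Nt0 : 0 <= N.+1%:R * t by rewrite mulr_ge0 // ltW.
  have := almost_orthogonal_bound mu_ uM sg (ltW delta0) Nt0 sr sA.
  rewrite sN -/G; apply/negP; rewrite -ltNge.
  rewrite (_ : _ + _ = N.+1%:R * (M ^+ 2 + N.+1%:R * delta + N.+1%:R * (t ^+ 2 * G)));
    last by ring.
  rewrite (_ : 2 * _ * _ = N.+1%:R * (2 * (N.+1%:R * (t * e)))); last by ring.
  rewrite ltr_pM2l//.
  have tG' : t ^+ 2 * G = t * e - t ^+ 2 by rewrite -tG; ring.
  have t2 : 0 < t ^+ 2 by rewrite exprn_gt0.
  rewrite tG'; have : t * e = 2 * delta by rewrite /delta; field.
  move=> ->; nra.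
move=> g sg; apply/cvgrPdist_lt => e e0.
have sNg : square_integrable (fun x => - g x).
  have [mg g2] := sg; split; first exact: measurableT_comp.
  by under [X in EFin \o X]eq_fun do rewrite sqrrN.
have nA1 : p (~` [set n | e <= I (fun x => u n x * g x)]).
  by have [/(key _ _ e0 sg)|] :=
    in_ultra_setVsetC [set n | e <= I (fun x => u n x * g x)] pU.
have nA2 : p (~` [set n | e <= I (fun x => u n x * - g x)]).
  by have [/(key _ _ e0 sNg)|] :=
    in_ultra_setVsetC [set n | e <= I (fun x => u n x * - g x)] pU.
apply: filterS (filterI nA1 nA2) => n [/= /negP n1 /negP n2].
have bu : bounded_measurable (u n) by split => //; exists M.
rewrite sub0r normrN ltr_norml; move: n1 n2; rewrite -!ltNge => ->; rewrite andbT.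
rewrite (_ : I (fun x => _ * - _) = - I (fun x => u n x * g x)); first by lra.
rewrite -mulN1r -meanZ; last by apply: bounded_integrableRM => //; exact: square_integrable_integrable.
by congr (I _); apply/funext => x; ring.
Qed.

End Integration.

(** * Complex-valued functions *)

Section ComplexNumbers.
Context (R : realType).
Implicit Types z w : R[i].

Local Notation Re := complex.Re.
Local Notation Im := complex.Im.

Lemma Re_addc z w : Re (z + w) = Re z + Re w.
Proof. by case: z w => ? ? []. Qed.
Lemma Im_addc z w : Im (z + w) = Im z + Im w.
Proof. by case: z w => ? ? []. Qed.
Lemma Re_mulc z w : Re (z * w) = Re z * Re w - Im z * Im w.
Proof. by case: z w => ? ? []. Qed.
Lemma Im_mulc z w : Im (z * w) = Re z * Im w + Im z * Re w.
Proof. by case: z w => ? ? []. Qed.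
Lemma Re_conjc z : Re (conjc z) = Re z. Proof. by case: z. Qed.
Lemma Im_conjc z : Im (conjc z) = - Im z. Proof. by case: z. Qed.

Lemma normc_ReIm z : Normc.normc z = Num.sqrt (Re z ^+ 2 + Im z ^+ 2).
Proof. by case: z. Qed.

Lemma normr_Re_le z : `|Re z| <= Normc.normc z.
Proof. by rewrite normc_ReIm -sqrtr_sqr ler_wsqrtr// lerDl sqr_ge0. Qed.

Lemma normr_Im_le z : `|Im z| <= Normc.normc z.
Proof. by rewrite normc_ReIm -sqrtr_sqr ler_wsqrtr// lerDr sqr_ge0. Qed.

Lemma normc_le z : Normc.normc z <= `|Re z| + `|Im z|.
Proof.
rewrite normc_ReIm -[leRHS]ger0_norm ?addr_ge0// -sqrtr_sqr ler_wsqrtr//.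
by rewrite sqrrD !real_normK ?num_real// addrAC lerDl mulrn_wge0// mulr_ge0.
Qed.

Lemma normc_ge0 z : 0 <= Normc.normc z.
Proof. by rewrite normc_ReIm sqrtr_ge0. Qed.

Lemma normc_sum (J : Type) (s : seq J) (F : J -> R[i]) :
  Normc.normc (\sum_(j <- s) F j) <= \sum_(j <- s) Normc.normc (F j).
Proof.
elim: s => [|j s IH]; first by rewrite !big_nil Normc.normc0.
by rewrite !big_cons (le_trans (le_normcD _ _))// lerD2l.
Qed.
End ComplexNumbers.

Section ComplexIntegration.
Context (d : measure_display) (X : measurableType d) (R : realType).
Context (mu : probability X R).
Implicit Types F G : X -> R[i].

Local Notation Re := complex.Re.
Local Notation Im := complex.Im.
Local Notation I := (Rintegral mu [set: X]).
Local Notation integrableR f := (mu.-integrable [set: X] (EFin \o f)).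

Definition measurable_complex F :=
  measurable_fun [set: X] (fun x => Re (F x)) /\
  measurable_fun [set: X] (fun x => Im (F x)).

Definition integrable_complex F :=
  integrableR (fun x => Re (F x)) /\ integrableR (fun x => Im (F x)).

Lemma measurable_complexM F G : measurable_complex F -> measurable_complex G ->
  measurable_complex (fun x => F x * G x).
Proof.
move=> [F1 F2] [G1 G2]; split.
  under eq_fun do rewrite Re_mulc.
  by apply: measurable_funB; exact: measurable_funM.
under eq_fun do rewrite Im_mulc.
by apply: measurable_funD; exact: measurable_funM.
Qed.

Lemma measurable_complex_conj F : measurable_complex F ->
  measurable_complex (fun x => conjc (F x)).
Proof.
move=> [F1 F2]; split; first by under eq_fun do rewrite Re_conjc.
under eq_fun do rewrite Im_conjc; exact: measurable_funN.
Qed.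

Lemma measurable_complex_prod (J : Type) (s : seq J) (F : J -> X -> R[i]) :
  (forall j, measurable_complex (F j)) ->
  measurable_complex (fun x => \prod_(j <- s) F j x).
Proof.
move=> mF; elim: s => [|j s IH].
  by split; under eq_fun do rewrite big_nil; exact: measurable_cst.
under eq_fun do rewrite big_cons; exact: measurable_complexM.
Qed.

Lemma measurable_complex_comp F (phi : X -> X) : measurable_fun [set: X] phi ->
  measurable_complex F -> measurable_complex (F \o phi).
Proof.
move=> mphi [F1 F2].
by split; [exact: (measurableT_comp F1 mphi)|exact: (measurableT_comp F2 mphi)].
Qed.

Lemma integralC_ae F G : measurable_complex F -> measurable_complex G ->
  {ae mu, forall x, F x = G x} -> integralC mu F = integralC mu G.
Proof.
move=> [F1 F2] [G1 G2] FG; rewrite /integralC /Rintegral.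
congr (fine _ +i* fine _); apply: ae_eq_integral => //; try exact/measurable_EFinP.
  by apply: filterS FG => x ->.
by apply: filterS FG => x ->.
Qed.

Lemma innerC_ae F G H : measurable_complex F -> measurable_complex G ->
  measurable_complex H ->
  {ae mu, forall x, F x = G x} -> innerC mu F H = innerC mu G H.
Proof.
move=> mF mG mH FG; apply: integralC_ae.
- exact: measurable_complexM mF (measurable_complex_conj mH).
- exact: measurable_complexM mG (measurable_complex_conj mH).
- by apply: filterS FG => x ->.
Qed.

Lemma integralCZ c F : integrable_complex F ->
  integralC mu (fun x => c * F x) = c * integralC mu F.
Proof.
move=> [F1 F2]; case: c => a b; rewrite /integralC.
have -> : (a +i* b) * (I (fun x => Re (F x)) +i* I (fun x => Im (F x))) =
  (a * I (fun x => Re (F x)) - b * I (fun x => Im (F x))) +i*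
  (a * I (fun x => Im (F x)) + b * I (fun x => Re (F x))) by [].
rewrite -!meanZ// -meanB -?meanD; try exact: integrableRZ.
by congr (I _ +i* I _); apply/funext => x; rewrite ?Re_mulc ?Im_mulc.
Qed.

Lemma integrable_complexZ c F : integrable_complex F ->
  integrable_complex (fun x => c * F x).
Proof.
move=> [F1 F2]; split.
  under [X in EFin \o X]eq_fun do rewrite Re_mulc.
  by apply: integrableRB; exact: integrableRZ.
under [X in EFin \o X]eq_fun do rewrite Im_mulc.
by apply: integrableRD; exact: integrableRZ.
Qed.

Lemma integralC_sum (J : Type) (s : seq J) (F : J -> X -> R[i]) :
  (forall j, integrable_complex (F j)) ->
  integralC mu (fun x => \sum_(j <- s) F j x) = \sum_(j <- s) integralC mu (F j).
Proof.
move=> iF.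
have Re_sum x : Re (\sum_(j <- s) F j x) = \sum_(j <- s) Re (F j x).
  exact: (big_morph _ (@Re_addc R) erefl).
have Im_sum x : Im (\sum_(j <- s) F j x) = \sum_(j <- s) Im (F j x).
  exact: (big_morph _ (@Im_addc R) erefl).
rewrite {1}/integralC; under eq_fun do rewrite Re_sum.
under [in X in _ +i* X]eq_fun do rewrite Im_sum.
rewrite !mean_sum; try by move=> j; have [] := iF j.
elim: s {Re_sum Im_sum} => [|j s IH]; first by rewrite !big_nil.
by rewrite !big_cons -IH.
Qed.

(** The squared norm written without the absolute value and the real power of
    the definition. *)
Lemma L2CP F : L2C mu F <->
  measurable_complex F /\
  (\int[mu]_x (Re (F x) ^+ 2 + Im (F x) ^+ 2)%:E < +oo)%E.
Proof.
have E : (\int[mu]_x (Re (F x) ^+ 2 + Im (F x) ^+ 2)%:E =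
    \int[mu]_x (`|(Normc.normc (F x))%:E| `^ 2))%E.
  apply: eq_integral => x _; rewrite abse_EFin poweR_EFin powR_mulrn//.
  rewrite real_normK ?num_real// normc_ReIm sqr_sqrtr//.
  by rewrite addr_ge0// sqr_ge0.
split=> [[F1 F2 F3]|[[F1 F2] F3]].
  by split => //; rewrite E -poweR_Lnorm//; exact: poweR_lty.
by split => //; rewrite /finite_norm unlock /Lnorm; apply: poweR_lty; rewrite -E.
Qed.

Lemma L2C_bounded F : bounded_measurable (fun x => Re (F x)) ->
  bounded_measurable (fun x => Im (F x)) -> L2C mu F.
Proof.
move=> b1 b2; apply/L2CP; split; first by split; [case: b1|case: b2].
have [_ f1] := bounded_square_integrable mu b1.
have [_ f2] := bounded_square_integrable mu b2.
exact: (integrable_lty _ (integrableRD f1 f2)).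
Qed.

Lemma L2C_ae F G : measurable_complex F -> L2C mu G ->
  {ae mu, forall x, F x = G x} -> L2C mu F.
Proof.
move=> mF /L2CP[mG fG] FG; apply/L2CP; split => //; move: fG.
have m2 H : measurable_complex H -> measurable_fun [set: X]
    (fun x => (Re (H x) ^+ 2 + Im (H x) ^+ 2)%:E).
  move=> [H1 H2]; apply/measurable_EFinP.
  by apply: measurable_funD; exact: measurable_funX.
rewrite (ae_eq_integral (fun x => (Re (F x) ^+ 2 + Im (F x) ^+ 2)%:E))//.
- exact: m2.
- exact: m2.
- by apply: filterS FG => x ->.
Qed.

Lemma L2C_square_integrable F : L2C mu F ->
  square_integrable mu (fun x => Re (F x)) /\
  square_integrable mu (fun x => Im (F x)).
Proof.
move=> /L2CP[[F1 F2]].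
have dom (a b : X -> R) : measurable_fun [set: X] a -> measurable_fun [set: X] b ->
    (\int[mu]_x (a x ^+ 2 + b x ^+ 2)%:E < +oo)%E -> square_integrable mu a.
  move=> ma mb fin; split => //; apply/integrableP; split.
    by apply/measurable_EFinP; exact: measurable_funX.
  apply: le_lt_trans fin; apply: ge0_le_integral => //=.
  - apply/measurable_EFinP; apply: measurableT_comp => //; exact: measurable_funX.
  - by apply/measurable_EFinP; apply: measurable_funD; exact: measurable_funX.
  - by move=> x _; rewrite lee_fin ger0_norm ?sqr_ge0// lerDl sqr_ge0.
move=> fin; split; first exact: dom F1 F2 fin.
by apply: (dom _ _ F2 F1); under eq_integral do rewrite addrC.
Qed.

(** Applied to the real and imaginary parts, clamping makes an essentially
    bounded function bounded and measurable by changing it on a null set. *)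
Definition clamp (M : R) (r : R) : R := Num.max (- M) (Num.min M r).

Lemma bounded_measurable_clamp M (f : X -> R) : measurable_fun [set: X] f ->
  bounded_measurable (fun x => clamp M (f x)).
Proof.
move=> mf; split.
  by apply: measurable_maxr => //; exact: measurable_minr.
exists `|M| => x; rewrite /clamp.
rewrite ler_norml le_max lerN2 ler_norm/= ge_max ge_min ler_norm andbT.
by rewrite -normrN ler_norm.
Qed.

Lemma clamp_id M r : `|r| <= M -> clamp M r = r.
Proof.
by rewrite ler_norml => /andP[Mr rM]; rewrite /clamp (min_idPr rM) (max_idPr Mr).
Qed.

Lemma LinftyC_ae_bounded F : LinftyC mu F ->
  exists M, {ae mu, forall x, Normc.normc (F x) <= M}.
Proof.
move=> [_ _]; rewrite /finite_norm unlock /Lnorm /= probability_setT lte01.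
move=> /ess_supr_bounded[M HM]; exists M; apply: filterS HM => x.
by rewrite ger0_norm// normc_ge0.
Qed.
End ComplexIntegration.

(** * Iterates of the transformation *)

Section Dynamics.
Context (d : measure_display) (X : measurableType d) (R : realType).
Context (mu : probability X R) (T : invertible_mps mu).
Implicit Types f g : X -> R.

Local Notation I := (Rintegral mu [set: X]).
Local Notation integrableR f := (mu.-integrable [set: X] (EFin \o f)).
Local Notation tau := (mps_iter T).

Lemma mps_iterS (a : int) x : tau (a + 1) x = T (tau a x).
Proof.
case: a => n; first by rewrite -PoszD addn1.
case: n => [|n]; first by rewrite /= mps_invK.
rewrite (_ : Negz n.+1 + 1 = Negz n); last by rewrite !NegzE; lia.
by rewrite /= mps_invK.
Qed.

Lemma mps_iterD (a b : int) x : tau (a + b) x = tau a (tau b x).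
Proof.
have posD (n : nat) c : tau (n%:Z + c) x = iter n T (tau c x).
  elim: n => [|n IH]; first by rewrite add0r.
  by rewrite (_ : n.+1%:Z + c = (n%:Z + c) + 1) ?mps_iterS ?IH//; lia.
case: a => n; first exact: posD.
have := posD n.+1 (Negz n + b).
rewrite addrA (_ : n.+1%:Z + Negz n = 0) ?add0r; last by rewrite NegzE; lia.
move=> ->; move: (tau (Negz n + b) x) => y.
have iterK m z : iter m (mps_inv T) (iter m T z) = z.
  elim: m => // m IH; rewrite [iter m.+1 T z]/= [LHS]iterSr mps_mapK; exact: IH.
by rewrite [RHS]iterK.
Qed.

Lemma measurable_mps_iter (a : int) : measurable_fun [set: X] (tau a).
Proof.
have iter_meas (f : X -> X) n : measurable_fun setT f ->
    measurable_fun setT (iter n f).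
  move=> mf; elim: n => [|n IH]; first exact: measurable_id.
  exact: (measurableT_comp mf IH).
case: a => n; apply: iter_meas; first exact: mps_measurable_map.
exact: mps_measurable_inv.
Qed.

Lemma mps_iter_preserves (a : int) (A : set X) : measurable A ->
  mu (tau a @^-1` A) = mu A.
Proof.
have iter_pres (f : X -> X) n : measurable_fun setT f ->
    (forall A, measurable A -> mu (f @^-1` A) = mu A) ->
    forall A, measurable A -> mu (iter n f @^-1` A) = mu A.
  move=> mf fmu; elim: n => // n IH B mB.
  have -> : iter n.+1 f @^-1` B = iter n f @^-1` (f @^-1` B) by [].
  by rewrite IH ?fmu// -[X in measurable X]setTI; exact: mf.
case: a => n; apply: iter_pres.
- exact: mps_measurable_map.
- exact: mps_preserves.
- exact: mps_measurable_inv.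
- move=> B mB; have mB' : measurable (mps_inv T @^-1` B).
    rewrite -[X in measurable X]setTI.
    exact: (mps_measurable_inv T measurableT mB).
  rewrite -(mps_preserves T mB'); congr (mu _).
  by apply/seteqP; split=> x /=; rewrite mps_mapK.
Qed.

Lemma bounded_measurable_comp (a : int) f :
  bounded_measurable f -> bounded_measurable (f \o tau a).
Proof.
move=> [mf [M fM]]; split; last by exists M => x; exact: fM.
by apply: measurableT_comp => //; exact: measurable_mps_iter.
Qed.

Lemma mean_mps_iter (a : int) f : bounded_measurable f -> I (f \o tau a) = I f.
Proof.
move=> bf; rewrite /Rintegral; congr fine.
have ma := measurable_mps_iter a.
have := @integral_pushforward _ _ _ _ R (tau a) ma mu setT (EFin \o f).
rewrite preimage_setT => /(_ _ _ measurableT) <-.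
- apply: eq_measure_integral => A mA _; exact: mps_iter_preserves.
- by apply/measurable_EFinP; case: bf.
- exact: bounded_measurable_integrable (bounded_measurable_comp a bf).
Qed.

Lemma ae_mps_iter (a : int) (Q : X -> Prop) :
  {ae mu, forall x, Q x} -> {ae mu, forall x, Q (tau a x)}.
Proof.
move=> [A [mA A0 QA]]; exists (tau a @^-1` A); split.
- by rewrite -[X in measurable X]setTI; exact: measurable_mps_iter.
- by rewrite mps_iter_preserves.
- by move=> x nQ; exact: QA.
Qed.

Section Mixing.
Context (p : set_system nat) (hp : idempotent_ultrafilter p).
Hypothesis hT : totally_p_mixing p T.

Let cplx (f : X -> R) : X -> R[i] := fun x => (f x)%:C%C.

Lemma normc_real (r : R) : Normc.normc (r%:C%C) = `|r|.
Proof. by rewrite /= expr0n /= addr0 sqrtr_sqr. Qed.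

Lemma L2C_real f : bounded_measurable f -> L2C mu (cplx f).
Proof.
move=> bf; apply: (@L2C_bounded _ _ _ mu (cplx f)); first exact: bf.
exact: bounded_measurable_cst.
Qed.

Lemma integralC_real f : integralC mu (cplx f) = (I f)%:C%C.
Proof.
by rewrite /integralC (_ : (fun x => complex.Im _) = (fun=> 0)) ?mean_cst.
Qed.

Lemma mixing_pos (l : nat) f g : (0 < l)%N ->
  bounded_measurable f -> bounded_measurable g ->
  I (fun x => f (tau (l * n)%N%:Z x) * g x) @[n --> p] --> I f * I g.
Proof.
move=> l0 bf bg; have pU := idempotent_ultra hp.
have [_ H] := hT (L2C_real bf) l0.
apply/cvgrPdist_lt => e e0.
have Hin (v : X -> R) : innerC mu (cplx v) (cplx g) = (I (fun x => v x * g x))%:C%C.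
  rewrite /innerC -integralC_real; congr (integralC mu _); apply/funext => x.
  by rewrite /cplx conjc_real -rmorphM.
pose U := [set v | Normc.normc (innerC mu v (cplx g) -
   innerC mu (fun=> integralC mu (cplx f)) (cplx g)) < e].
have wU : weak_nbhs mu (fun=> integralC mu (cplx f)) U.
  exists 1%N, (fun=> cplx g), e; split => //; first by move=> _; exact: L2C_real.
  by move=> v _ /(_ ord0).
apply: filterS (H U wU) => n Un.
have : Normc.normc (innerC mu (koopman T (l * n)%N%:Z (cplx f)) (cplx g) -
  innerC mu (fun=> integralC mu (cplx f)) (cplx g)) < e by exact: Un.
rewrite integralC_real -[koopman _ _ _]/(cplx (f \o tau _)).
rewrite -[fun _ => (I f)%:C%C]/(cplx (fun=> I f)) !Hin -rmorphB normc_real.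
rewrite meanZ; last exact: bounded_measurable_integrable.
by rewrite distrC.
Qed.

(** For a negative the iterates are moved to g by invariance of the measure. *)
Lemma mixing (a : int) f g : a != 0 ->
  bounded_measurable f -> bounded_measurable g ->
  I (fun x => f (tau (a * n%:Z) x) * g x) @[n --> p] --> I f * I g.
Proof.
have pU := idempotent_ultra hp.
move=> a0 bf bg; case: a a0 => l l0.
  by apply: mixing_pos => //; move: l0; case: l.
rewrite mulrC; have := @mixing_pos l.+1 g f isT bg bf.
apply: cvg_trans; apply: near_eq_cvg; near=> n.
rewrite -[RHS](mean_mps_iter (l.+1 * n)%N%:Z); last first.
  apply: bounded_measurableM => //.
  exact: bounded_measurable_comp bf.
congr (I _); apply/funext => x; rewrite [RHS]/comp.
rewrite -mps_iterD mulrC; congr (f _ * _).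
by rewrite NegzE PoszM mulNr addNr.
Unshelve. all: by end_near.
Qed.

End Mixing.
End Dynamics.

(** * Polynomial exhaustion for real functions *)

Section PolynomialExhaustion.
Context (d : measure_display) (X : measurableType d) (R : realType).
Context (mu : probability X R) (T : invertible_mps mu).
Context (p : set_system nat) (hp : idempotent_ultrafilter p).
Hypothesis hT : totally_p_mixing p T.
Implicit Types (J : eqType) (g : X -> R).

Local Notation I := (Rintegral mu [set: X]).
Local Notation integrableR f := (mu.-integrable [set: X] (EFin \o f)).
Local Notation tau := (mps_iter T).

Definition orbit_prod J (s : seq J) (P : J -> {poly int}) (f : J -> X -> R)
    (n : nat) (x : X) : R :=
  \prod_(j <- s) f j (tau (P j).[n%:Z] x).

(** The test function ranges over all of L^2, not only over bounded functions,
    because the weak topology is tested there and the van der Corput inequality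
    yields this generality directly. *)
Definition jointly_mixing J (s : seq J) (P : J -> {poly int}) : Prop :=
  forall f g, (forall j, bounded_measurable (f j)) -> square_integrable mu g ->
  I (fun x => orbit_prod s P f n x * g x) @[n --> p] -->
    (\prod_(j <- s) I (f j)) * I g.

Lemma orbit_prod_bounded J (s : seq J) P f :
  (forall j, bounded_measurable (f j)) ->
  exists M : R, forall n x, `|orbit_prod s P f n x| <= M.
Proof.
move=> bf; rewrite /orbit_prod; elim: s => [|j s [M HM]].
  by exists 1 => n x; rewrite big_nil normr1.
have [_ [N HN]] := bf j; exists (N * M) => n x.
by rewrite big_cons normrM ler_pM.
Qed.

Lemma bounded_measurable_orbit_prod J (s : seq J) P f n :
  (forall j, bounded_measurable (f j)) ->
  bounded_measurable (orbit_prod s P f n).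
Proof.
by move=> bf; apply: bounded_measurable_prod => j _; exact: bounded_measurable_comp.
Qed.

(** The functions that accompany [pet_poly].  A linear polynomial P j satisfies
    P j (n + h) = P j n + lead_coef (P j) * h, so that its two occurrences are
    merged into a single function, which depends on h. *)
Definition pet_fun J (P : J -> {poly int}) (f : J -> X -> R) (h : nat)
    (k : J + J) : X -> R :=
  match k with
  | inl j => f j
  | inr j => if (2 < size (P j))%N then f j
             else fun x => f j (tau (lead_coef (P j) * h%:Z) x) * f j x
  end.

Lemma bounded_measurable_pet_fun J P (f : J -> X -> R) h k :
  (forall j, bounded_measurable (f j)) -> bounded_measurable (pet_fun P f h k).
Proof.
move=> bf; case: k => j //=; case: ifP => // _.
by apply: bounded_measurableM => //; exact: bounded_measurable_comp (bf j).
Qed.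

Section Step.
Context J (s : seq J) (P : J -> {poly int}) (i0 : J).
Hypothesis (us : uniq s) (si0 : i0 \in s).
Hypothesis edP : essentially_distinct s P.

(** Both sides are the product over s of the factors at n + h and at n; on the
    right these are read from the point tau (P i0 n) x, and the factor of inr i0
    is separated because its polynomial is 0. *)
Lemma orbit_prod_pet f n h x :
  orbit_prod s P f (n + h) x * orbit_prod s P f n x =
  ((fun y => orbit_prod (pet_seq s P i0) (pet_poly P i0 h) (pet_fun P f h) n y *
     pet_fun P f h (inr i0) y) \o tau (P i0).[n%:Z]) x.
Proof.
have tauE (q : {poly int}) : tau (q - P i0).[n%:Z] (tau (P i0).[n%:Z] x) =
    tau q.[n%:Z] x by rewrite -mps_iterD hornerD hornerN subrK.
rewrite /= {3}/orbit_prod big_cat !big_map !big_filter.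
set A := (X in _ = X * _ * _); set B := (X in _ = _ * X * _).
have AE : A = \prod_(j <- s | (2 < size (P j))%N) f j (tau (P j).[(n + h)%N%:Z] x).
  by apply: eq_bigr => j _; rewrite /= tauE horner_shift_poly.
have BE : B * pet_fun P f h (inr i0) (tau (P i0).[n%:Z] x) =
    \prod_(j <- s) pet_fun P f h (inr j) (tau (P j).[n%:Z] x).
  rewrite (bigD1_seq i0 si0 us) mulrC; congr (_ * _).
  by apply: eq_bigr => j _; rewrite tauE.
rewrite -mulrA BE AE big_mkcond -!big_split; apply: eq_big_seq => j sj /=.
case: ifPn => // sj2; rewrite mul1r; congr (_ * _).
have [/(_ _ sj) sj1 _] := edP.
have sz : size (P j) = 2 by apply/eqP; rewrite eqn_leq sj1 andbT leqNgt.
by rewrite horner_linear// (addrC (P j).[_]) mps_iterD.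
Qed.

(** The correlations of the sequence converge, for p-many h, to the product of
    the integrals of the new functions.  As h runs along p, each of these
    integrals tends to the integral of f j or to its square, so that the factor
    coming from the function of integral 0 makes the product vanish. *)
Lemma jointly_mixing_pet_mean_zero f g :
  {in s, forall j, size (P i0) <= size (P j)}%N ->
  (forall h, essentially_distinct (pet_seq s P i0) (pet_poly P i0 h) ->
     jointly_mixing (pet_seq s P i0) (pet_poly P i0 h)) ->
  (forall j, bounded_measurable (f j)) -> square_integrable mu g ->
  (exists2 j, j \in s & I (f j) = 0) ->
  I (fun x => orbit_prod s P f n x * g x) @[n --> p] --> 0.
Proof.
move=> min_i0 mixpet bf sg [i1 si1 Ii1]; have pU := idempotent_ultra hp.
have [M uM] := @orbit_prod_bounded J s P f bf.
pose s' := inr i0 :: pet_seq s P i0.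
pose c h := \prod_(k <- s') I (pet_fun P f h k).
pose L (k : J + J) := match k with inl j => I (f j)
   | inr j => if (2 < size (P j))%N then I (f j) else I (f j) * I (f j) end.
apply: (@ultra_van_der_corput _ _ _ mu p hp (orbit_prod s P f) M c) => //.
- by move=> n; have [] := bounded_measurable_orbit_prod s P n bf.
- have := essentially_distinct_pet si0 edP hp.
  apply: filterS => h /mixpet /(_ (pet_fun P f h) (pet_fun P f h (inr i0))).
  have bpf k := @bounded_measurable_pet_fun J P f h k bf.
  move=> /(_ bpf (bounded_square_integrable mu (bpf _))).
  move=> lim_h; rewrite /c /s' /= big_cons mulrC.
  apply: cvg_trans lim_h; apply: near_eq_cvg; near=> n.
  rewrite -[LHS](mean_mps_iter T (P i0).[n%:Z]); last first.
    by apply: bounded_measurableM => //; exact: bounded_measurable_orbit_prod.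
  by congr (I _); apply/funext => x; rewrite orbit_prod_pet.
- have [nc _] := edP.
  (* The index inr i1 belongs to the family in all cases, including i1 = i0,
     and its limit is 0 or 0 * 0. *)
  have -> : 0 = \prod_(k <- s' | k \in s') L k.
    have i1s' : inr i1 \in s'.
      rewrite inE; have [->|ne] := eqVneq i1 i0; first by rewrite eqxx.
      by rewrite mem_pet_seq_inr ne si1 orbT.
    apply/esym/eqP; rewrite -big_seq prodf_seq_eq0; apply/hasP.
    by exists (inr i1) => //=; rewrite Ii1 mulr0 if_same eqxx.
  rewrite /c; under eq_fun do rewrite big_seq.
  apply: cvg_big; first exact: mul_continuous.
  move=> [j|j] /=; first by move=> _; exact: cvg_cst.
  have [_ _|sj2 js'] := ltnP 2 (size (P j)); first exact: cvg_cst.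
  apply: mixing => //; rewrite lead_coef_eq0 -size_poly_gt0.
  have sj : j \in s.
    move: js'; rewrite inE => /predU1P[[->//]|].
    by rewrite mem_pet_seq_inr => /andP[].
  exact: ltnW (nc j sj).
Unshelve. all: by end_near.
Qed.
End Step.

(** Each f j is the sum of its integral and of a function of integral 0.  The
    functions are replaced by their integrals one after the other, t being the
    list of those not yet known to be constant. *)
Lemma jointly_mixing_mean_zero J (s : seq J) P : uniq s ->
  (forall f g, (forall j, bounded_measurable (f j)) -> square_integrable mu g ->
     (exists2 j, j \in s & I (f j) = 0) ->
     I (fun x => orbit_prod s P f n x * g x) @[n --> p] --> 0) ->
  jointly_mixing s P.
Proof.
move=> us H f g bf sg; have pU := idempotent_ultra hp.
suff gen (t : seq J) : forall f, (forall j, bounded_measurable (f j)) ->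
    {in s, forall j, j \notin t -> f j = fun=> I (f j)} ->
    I (fun x => orbit_prod s P f n x * g x) @[n --> p] -->
      (\prod_(j <- s) I (f j)) * I g.
  by apply: (gen s) => // j sj; rewrite sj.
have gi := square_integrable_integrable sg.
elim: t {f bf} => [|j t IH] f bf cf.
  have -> : (fun n => I (fun x => orbit_prod s P f n x * g x)) =
      (fun=> (\prod_(j <- s) I (f j)) * I g).
    apply/funext => n; rewrite -meanZ//; congr (I _); apply/funext => x.
    by congr (_ * _); apply: eq_big_seq => j sj; rewrite {1}cf.
  exact: cvg_cst.
have [sj|sj] := boolP (j \in s); last first.
  apply: IH => // i si it; apply: cf => //; rewrite inE negb_or it andbT.
  by apply: contraNneq sj => <-.
pose upd (v : X -> R) i := if i == j then v else f i.
pose f1 := upd (fun=> I (f j)); pose f2 := upd (fun x => f j x - I (f j)).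
have bupd v : bounded_measurable v -> forall i, bounded_measurable (upd v i).
  by move=> bv i; rewrite /upd; case: ifP.
have bf1 : forall i, bounded_measurable (f1 i).
  by apply: bupd; exact: bounded_measurable_cst.
have bf2 : forall i, bounded_measurable (f2 i).
  by apply: bupd; apply: bounded_measurableB => //; exact: bounded_measurable_cst.
have If1 i : I (f1 i) = I (f i).
  by rewrite /f1 /upd; case: eqP => // ->; rewrite mean_cst.
have opE n x : orbit_prod s P f n x = orbit_prod s P f1 n x + orbit_prod s P f2 n x.
  rewrite /orbit_prod !(bigD1_seq j sj us) /= /f1 /f2 /upd eqxx.
  have E v : \prod_(i <- s | i != j) (if i == j then v else f i) (tau (P i).[n%:Z] x) =
      \prod_(i <- s | i != j) f i (tau (P i).[n%:Z] x).
    by apply: eq_bigr => i /negPf ->.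
  by rewrite !E -mulrDl subrKC.
have -> : (\prod_(i <- s) I (f i)) * I g = (\prod_(i <- s) I (f1 i)) * I g + 0.
  by rewrite addr0; congr (_ * _); apply: eq_bigr => i _; rewrite If1.
have -> : (fun n => I (fun x => orbit_prod s P f n x * g x)) =
    (fun n => I (fun x => orbit_prod s P f1 n x * g x) +
              I (fun x => orbit_prod s P f2 n x * g x)).
  apply/funext => n; rewrite -meanD.
  - by congr (I _); apply/funext => x; rewrite opE mulrDl.
  - by apply: bounded_integrableRM => //; exact: bounded_measurable_orbit_prod.
  - by apply: bounded_integrableRM => //; exact: bounded_measurable_orbit_prod.
apply: cvgD.
  apply: IH => // i si it; rewrite If1; have [ij|ij] := eqVneq i j.
    by rewrite /f1 /upd ij eqxx.
  by rewrite /f1 /upd (negPf ij) {1}cf// inE negb_or ij.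
apply: H => //; exists j => //; rewrite /f2 /upd eqxx meanB ?mean_cst ?subrr//.
  exact: bounded_measurable_integrable.
by apply: bounded_measurable_integrable; exact: bounded_measurable_cst.
Qed.

Lemma seq_argmin J (s : seq J) (F : J -> nat) : s != [::] ->
  exists2 i, i \in s & {in s, forall j, F i <= F j}%N.
Proof.
elim: s => // i s IH _; have [->|s0] := eqVneq s [::].
  by exists i; rewrite ?mem_head// => j; rewrite inE => /eqP->.
have [k sk kmin] := IH s0; have [ik|ki] := leqP (F i) (F k).
  exists i; rewrite ?mem_head// => j; rewrite inE => /predU1P[->//|sj].
  exact: leq_trans ik (kmin j sj).
exists k; first by rewrite inE sk orbT.
by move=> j; rewrite inE => /predU1P[->|/kmin//]; exact: ltnW.
Qed.

(** Induction on the weight; the bound b on the sizes, which the passage to the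
    new family preserves, makes the lexicographic order well founded. *)
Lemma essentially_distinct_jointly_mixing_le (b : nat) :
  forall w J (s : seq J) P, uniq s -> essentially_distinct s P ->
    {in s, forall j, size (P j) <= b}%N -> weight s P =1 w ->
  jointly_mixing s P.
Proof.
apply: (@top_lexicographic_ind b.+1) => w IH J s P us edP sb ws.
have pU := idempotent_ultra hp.
apply: jointly_mixing_mean_zero => // f g bf sg [j1 sj1 Ij1].
have s0 : s != [::] by apply: contraTneq sj1 => ->.
have [i0 si0 min_i0] := seq_argmin (fun j => size (P j)) s0.
apply: (jointly_mixing_pet_mean_zero us si0 edP min_i0) => //; last by exists j1.
move=> h edQ; apply: (IH (weight (pet_seq s P i0) (pet_poly P i0 h))) => //.
- exists (size (P i0)); split; first by rewrite ltnS sb.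
    by rewrite -ws; exact: weight_pet_at.
  by move=> m im; rewrite -ws; exact: weight_pet_above.
- exact: uniq_pet_seq.
- exact: size_pet_poly_le.
Qed.

Theorem essentially_distinct_jointly_mixing J (s : seq J) P :
  uniq s -> essentially_distinct s P -> jointly_mixing s P.
Proof.
move=> us edP.
apply: (@essentially_distinct_jointly_mixing_le
  (\max_(j <- s) size (P j))%N (weight s P)) => //.
by move=> j sj; rewrite (big_rem j sj) leq_maxl.
Qed.
End PolynomialExhaustion.

(** * From real to complex functions *)

Section Transfer.
Context (d : measure_display) (X : measurableType d) (R : realType).
Context (mu : probability X R).

Local Notation Re := complex.Re.
Local Notation Im := complex.Im.
Local Notation I := (Rintegral mu [set: X]).
Local Notation integrableR f := (mu.-integrable [set: X] (EFin \o f)).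

Lemma innerC_real (v : X -> R) (g : X -> R[i]) :
  bounded_measurable v -> L2C mu g ->
  integrable_complex mu (fun x => (v x)%:C * conjc (g x)) /\
  innerC mu (fun x => (v x)%:C) g =
    I (fun x => v x * Re (g x)) -i* I (fun x => v x * Im (g x)).
Proof.
move=> bv /L2C_square_integrable[s1 s2].
have ReE x : Re ((v x)%:C * conjc (g x)) = v x * Re (g x).
  by rewrite Re_mulc Re_conjc mul0r subr0.
have ImE x : Im ((v x)%:C * conjc (g x)) = -1 * (v x * Im (g x)).
  by rewrite Im_mulc Im_conjc mul0r addr0 mulrN mulN1r.
have i1 := bounded_integrableRM bv (square_integrable_integrable s1).
have i2 := bounded_integrableRM bv (square_integrable_integrable s2).
split.
  split; first by under [X in EFin \o X]eq_fun do rewrite ReE.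
  by under [X in EFin \o X]eq_fun do rewrite ImE; exact: integrableRZ.
rewrite /innerC /integralC; congr (_ +i* _).
  by congr (I _); apply/funext => x; rewrite ReE.
rewrite -mulN1r -meanZ//.
by congr (I _); apply/funext => x; rewrite ImE.
Qed.

Lemma innerC_sum (J : Type) (s : seq J) (c : J -> R[i]) (v : J -> X -> R)
    (g : X -> R[i]) :
  (forall j, bounded_measurable (v j)) -> L2C mu g ->
  innerC mu (fun x => \sum_(j <- s) c j * (v j x)%:C) g =
  \sum_(j <- s) c j * innerC mu (fun x => (v j x)%:C) g.
Proof.
move=> bv Lg.
have iv j := (innerC_real (bv j) Lg).1.
rewrite /innerC; under eq_fun do rewrite mulr_suml.
rewrite integralC_sum.
  apply: eq_bigr => j _; rewrite -integralCZ//.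
  by congr (integralC mu _); apply/funext => x; rewrite mulrA.
move=> j; have := integrable_complexZ (c j) (iv j).
by congr (integrable_complex mu _); apply/funext => x; rewrite mulrA.
Qed.

(** The inner product of a real function with g has the integrals against the
    real and imaginary parts of g as its coordinates, up to sign. *)
Lemma innerC_real_cvg (p : set_system nat) (pF : Filter p) (v : nat -> X -> R)
    (m : R) (g : X -> R[i]) :
  (forall n, bounded_measurable (v n)) -> L2C mu g ->
  (forall h, square_integrable mu h ->
    I (fun x => v n x * h x) @[n --> p] --> m * I h) ->
  Normc.normc (innerC mu (fun x => (v n x)%:C) g -
    innerC mu (fun=> m%:C) g) @[n --> p] --> 0.
Proof.
move=> bv Lg mix; have [s1 s2] := L2C_square_integrable Lg.
have bm := @bounded_measurable_cst d X R m.
pose E n := `|I (fun x => v n x * Re (g x)) - m * I (fun x => Re (g x))| +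
   `|I (fun x => v n x * Im (g x)) - m * I (fun x => Im (g x))|.
have E0 : E n @[n --> p] --> (0 : R).
  rewrite -[0](addr0 (0 : R)) /E; apply: cvgD.
    by apply/norm_cvg0P/subr_cvg0/mix.
  by apply/norm_cvg0P/subr_cvg0/mix.
apply: (@squeeze_cvgr _ _ _ _ (fun=> 0) E) => //; last exact: cvg_cst.
near=> n; rewrite normc_ge0 andTb (le_trans (normc_le _))//.
rewrite (innerC_real (bv n) Lg).2 (innerC_real bm Lg).2 /= /E.
rewrite !meanZ//; try exact: square_integrable_integrable.
by rewrite lerD2l -opprD normrN.
Unshelve. all: by end_near.
Qed.

End Transfer.

Section Main.
Context (d : measure_display) (X : measurableType d) (R : realType).
Context (mu : probability X R) (T : invertible_mps mu).

Local Notation Re := complex.Re.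
Local Notation Im := complex.Im.
Local Notation I := (Rintegral mu [set: X]).

Lemma complex_split (z : R[i]) : z = (Re z)%:C + (0 +i* 1) * (Im z)%:C.
Proof.
by case: z => a b; apply/eqP; rewrite eq_complex /=
  !(mul0r, mulr0, mul1r, subr0, addr0, add0r) !eqxx.
Qed.

(** The map e records in which factors the real part is chosen. *)
Lemma prod_split (k : nat) (a b : 'I_k -> R) :
  \prod_(i < k) (a i +i* b i) = \sum_(e : {ffun 'I_k -> bool})
    (\prod_(i < k) (if e i then 1 else 0 +i* 1)) *
    (\prod_(i < k) (if e i then a i else b i))%:C.
Proof.
pose F (i : 'I_k) (t : bool) : R[i] := if t then (a i)%:C else (0 +i* 1) * (b i)%:C.
under eq_bigr => i _.
  rewrite (_ : _ +i* _ = \sum_(t : bool) F i t); last first.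
    by rewrite big_bool /F /= [LHS]complex_split.
  over.
rewrite bigA_distr_bigA /=; apply: eq_bigr => e _.
rewrite rmorph_prod -big_split /=; apply: eq_bigr => i _.
by rewrite /F; case: (e i); rewrite ?mul1r.
Qed.

(** The theorem for bounded functions.  Expanding the product over real and
    imaginary parts turns it into finitely many real products, indexed by the
    maps e that choose one of the two parts in each factor, and into the same
    combination of their limits. *)
Lemma innerC_koopman_prod_cvg (p : set_system nat)
    (hp : idempotent_ultrafilter p) (hT : totally_p_mixing p T)
    (k : nat) (P : 'I_k -> {poly int}) (a b : 'I_k -> X -> R) :
  (forall i, (1 < size (P i))%N) ->
  (forall i j, i != j -> (1 < size (P i - P j)%R)%N) ->
  (forall i, bounded_measurable (a i)) ->
  (forall i, bounded_measurable (b i)) ->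
  let F i x := a i x +i* b i x in
  let u n x := \prod_(i < k) koopman T (P i).[n%:Z] (F i) x in
  (forall n, L2C mu (u n)) /\
  forall g, L2C mu g -> Normc.normc (innerC mu (u n) g -
    innerC mu (fun=> \prod_(i < k) integralC mu (F i)) g) @[n --> p] --> 0.
Proof.
move=> hPnc hP ba bb F u; have pU := idempotent_ultra hp.
pose c (e : {ffun 'I_k -> bool}) : R[i] := \prod_(i < k) (if e i then 1 else 0 +i* 1).
pose w (e : {ffun 'I_k -> bool}) i : X -> R := if e i then a i else b i.
have bw e i : bounded_measurable (w e i) by rewrite /w; case: (e i).
pose v n (e : {ffun 'I_k -> bool}) := orbit_prod T (index_enum 'I_k) P (w e) n.
have bv n e : bounded_measurable (v n e) by exact: bounded_measurable_orbit_prod.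
have uE n : u n = fun x => \sum_e c e * (v n e x)%:C.
  apply/funext => x; rewrite /u /koopman /F /= prod_split.
  apply: eq_bigr => e _; congr (_ * _%:C); apply: eq_bigr => i _.
  by rewrite /w; case: (e i).
pose m e := \prod_(i < k) I (w e i).
have limE : \prod_(i < k) integralC mu (F i) = \sum_e c e * (m e)%:C.
  rewrite prod_split; apply: eq_bigr => e _; congr (_ * _%:C).
  by apply: eq_bigr => i _; rewrite /w; case: (e i).
have jm : jointly_mixing T p (index_enum 'I_k) P.
  apply: (essentially_distinct_jointly_mixing hp hT).
    exact: index_enum_uniq.
  by split=> [i _|i j _ _]; [exact: hPnc|exact: hP].
have bcst (r : R) : bounded_measurable (fun=> r : R) := @bounded_measurable_cst d X R r.
split=> [n|g Lg].
  rewrite uE.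
  have Re_sum x : Re (\sum_e c e * (v n e x)%:C) = \sum_e Re (c e) * v n e x.
    rewrite (big_morph _ (@Re_addc R) erefl).
    by apply: eq_bigr => e _; rewrite Re_mulc mulr0 subr0.
  have Im_sum x : Im (\sum_e c e * (v n e x)%:C) = \sum_e Im (c e) * v n e x.
    rewrite (big_morph _ (@Im_addc R) erefl).
    by apply: eq_bigr => e _; rewrite Im_mulc mulr0 add0r.
  apply: L2C_bounded.
    under eq_fun do rewrite Re_sum.
    by apply: bounded_measurable_sum => e; exact: bounded_measurableM.
  under eq_fun do rewrite Im_sum.
  by apply: bounded_measurable_sum => e; exact: bounded_measurableM.
rewrite limE.
pose D n e := innerC mu (fun x => (v n e x)%:C) g - innerC mu (fun=> (m e)%:C) g.
have DE n : innerC mu (u n) g - innerC mu (fun=> \sum_e c e * (m e)%:C) g =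
    \sum_e c e * D n e.
  rewrite uE !innerC_sum// -sumrB.
  by apply: eq_bigr => e _; rewrite -mulrBr.
have lim0 : \sum_e Normc.normc (c e) * Normc.normc (D n e) @[n --> p] --> (0 : R).
  rewrite [X in _ --> X](_ : 0 =
      \sum_(e : {ffun 'I_k -> bool}) Normc.normc (c e) * (0 : R)); last first.
    by rewrite big1// => e _; rewrite mulr0.
  apply: cvg_big; first exact: add_continuous.
  move=> e _; apply: cvgM; first exact: cvg_cst.
  by apply: innerC_real_cvg => // h sh; exact: jm.
apply: (squeeze_cvgr _ (cvg_cst (0 : R)) lim0); near=> n.
rewrite normc_ge0 andTb DE (le_trans (normc_sum _ _))//.
by apply: ler_sum => e _; rewrite Normc.normcM.
Unshelve. all: by end_near.
Qed.
End Main.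

Theorem theorem7p5 (d : measure_display) (X : measurableType d) (R : realType)
    (mu : probability X R) (T : invertible_mps mu) (p : set_system nat)
    (hp : idempotent_ultrafilter p) (hT : totally_p_mixing p T)
    (k : nat) (P : 'I_k -> {poly int})
    (hPnc : forall i, (1 < size (P i))%N)
    (hP : forall i j, i != j -> (1 < size (P i - P j)%R)%N)
    (f : 'I_k -> X -> R[i]) (hf : forall i, LinftyC mu (f i)) :
  weak_plim mu p
    (fun n x => \prod_(i < k) koopman T (P i).[n%:Z] (f i) x)
    (fun _ => \prod_(i < k) integralC mu (f i)).
Proof.
have pU := idempotent_ultra hp.
have mf i : measurable_complex (f i) by have [] := hf i.
have /choice[M HM] : forall i, exists M,
    {ae mu, forall x, Normc.normc (f i x) <= M}.
  by move=> i; exact: LinftyC_ae_bounded.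
(* Truncation gives bounded functions f' that agree with the f almost
   everywhere, hence also along the orbits. *)
pose a i x := clamp (M i) (complex.Re (f i x)).
pose b i x := clamp (M i) (complex.Im (f i x)).
have ba i : bounded_measurable (a i).
  by apply: bounded_measurable_clamp; case: (mf i).
have bb i : bounded_measurable (b i).
  by apply: bounded_measurable_clamp; case: (mf i).
pose f' i x := a i x +i* b i x.
have mf' i : measurable_complex (f' i) by split; [case: (ba i)|case: (bb i)].
have ff' i : {ae mu, forall x, f i x = f' i x}.
  apply: filterS (HM i) => x fM.
  rewrite /f' /a /b !clamp_id; first by case: (f i x).
    exact: le_trans (normr_Im_le _) fM.
  exact: le_trans (normr_Re_le _) fM.
pose u n x := \prod_(i < k) koopman T (P i).[n%:Z] (f i) x.
pose u' n x := \prod_(i < k) koopman T (P i).[n%:Z] (f' i) x.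
have mu_ n : measurable_complex (u n).
  apply: measurable_complex_prod => i.
  exact: (measurable_complex_comp (measurable_mps_iter T (P i).[n%:Z]) (mf i)).
have mu'_ n : measurable_complex (u' n).
  apply: measurable_complex_prod => i.
  exact: (measurable_complex_comp (measurable_mps_iter T (P i).[n%:Z]) (mf' i)).
have uu' n : {ae mu, forall x, u n x = u' n x}.
  have : {ae mu, forall x, {in index_enum 'I_k, forall i,
      f i (mps_iter T (P i).[n%:Z] x) = f' i (mps_iter T (P i).[n%:Z] x)}}.
    apply: filter_all_seq => i _; exact: ae_mps_iter (ff' i).
  by apply: filterS => x Hx; apply: eq_big_seq => i /Hx.
have limE : \prod_(i < k) integralC mu (f i) = \prod_(i < k) integralC mu (f' i).
  by apply: eq_bigr => i _; exact: integralC_ae.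
have [Lu' cvg_u'] := innerC_koopman_prod_cvg hp hT hPnc hP ba bb.
have Lu n : L2C mu (u n) by exact: L2C_ae (Lu' n) (uu' n).
split; first by apply: L2C_bounded; exact: bounded_measurable_cst.
move=> U [q [g [eps [Lg eps0 HU]]]].
have : p [set n | {in index_enum 'I_q, forall j, Normc.normc
    (innerC mu (u n) (g j) -
     innerC mu (fun=> \prod_(i < k) integralC mu (f i)) (g j)) < eps}].
  apply: filter_all_seq => j _; rewrite limE.
  have mg : measurable_complex (g j) by have [] := Lg j.
  have /cvgrPdist_lt/(_ _ eps0) := cvg_u' (g j) (Lg j).
  apply: filterS => n; rewrite sub0r normrN => /(le_lt_trans (ler_norm _)).
  by rewrite -(innerC_ae (mu_ n) (mu'_ n) mg (uu' n)).
apply: filterS => n Hn; apply: (HU _ (Lu n)) => j.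
by apply: Hn; exact: mem_index_enum.
Qed.
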